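(* Let $D=(D_1,\dots,D_L)$ be a sequence of vectors in $\mathbb{R}^N$, and let $P$ be a segmentation of $D$. Then there is a segmentation $P'$ of $D$ such that $\mathrm{score}(P';D)\ge \mathrm{score}(P;D)$ and, for any two consecutive segments $I$ and $J$ of $P'$ ($J$ immediately following $I$), the difference set $\Delta(D[I],D[J])$ is not a cover.
   Context: A log-linear model on $\mathbb{R}^N$ (with sufficient statistic the identity, $S(x)=x$) has densities $p(x\mid r)=q(x)\exp(Z(r)+r^Tx)$, $r\in\mathbb{R}^N$, where $Z(r)$ is the normalization constant; fix such a model. A segment $I=[b,e]$ of a sequence $D=(D_1,\dots,D_L)$ is a pair of integers $1\le b\le e\le L$, and $D[b,e]=(D_b,\dots,D_e)$. A segmentation is a list of segments $I_1,\dots,I_K$ with $I_1$ starting at $1$, $I_K$ ending at $L$, and each $I_k$ starting right after the end of $I_{k-1}$. For a sequence $E$ write $\Sigma(E)=\sum_i E_i$ and $\bar E=\Sigma(E)/|E|$ (the average). The score of a sequence $E$ given $r$ is $\mathrm{score}(E\mid r)=|E|Z(r)+r^T\Sigma(E)$, and $\mathrm{score}(E)=\sup_r \mathrm{score}(E\mid r)$. The score of a segmentation $P$ is $\mathrm{score}(P;D)=\sum_{I\in P}\mathrm{score}(D[I])$. A set $V\subseteq\mathbb{R}^N$ is a cover if for every $y\in\mathbb{R}^N$ there is $v\in V$ with $y^Tv\ge 0$. For sequences $E,F$ of vectors in $\mathbb{R}^N$, the difference set is $\Delta(E,F)=\{\overline{E[k,|E|]}-\overline{F[1,l]} : 1\le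 k\le |E|,\ 1\le l\le |F|\}$. *)

(* Defs.v *)
From HB Require Import structures.
From mathcomp Require Import all_boot all_order all_algebra.
From mathcomp Require Import all_classical all_reals all_analysis.

Set Implicit Arguments.
Unset Strict Implicit.
Unset Printing Implicit Defensive.

Import Order.TTheory GRing.Theory Num.Theory.
Import numFieldNormedType.Exports.

Local Open Scope classical_set_scope.
Local Open Scope ring_scope.

Definition dot (R : realType) (N : nat) (x y : 'cV[R]_N) : R :=
  (x^T *m y) 0 0.

(* R^N with its Borel sigma-algebra. *)
Definition borelV (R : realType) (N : nat) : measurableType _ :=
  g_sigma_algebraType [set A : set 'cV[R]_N | open A].

Definition density (R : realType) (N : nat) (q Z : 'cV[R]_N -> R)
    (r x : 'cV[R]_N) : R :=
  q x * expR (Z r + dot r x).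

(* Densities are taken with respect to an arbitrary reference measure mu, so
   that both the continuous case and the discrete case are covered.  As q is
   nonnegative, the last clause determines Z from mu and q: it says that
   Z r = - ln (\int[mu]_x (q x * expR (dot r x))) for every r. *)
Definition log_linear_model (R : realType) (N : nat)
    (mu : {measure set (borelV R N) -> \bar R}) (q Z : 'cV[R]_N -> R) : Prop :=
  [/\ forall x, 0 <= q x,
      measurable_fun [set: borelV R N] (q : borelV R N -> R)
    & forall r, (\int[mu]_x (density q Z r x)%:E = 1)%E].

(* E[b, e] = (E_b, ..., E_e), with 1-based indices. *)
Definition subrange (T : Type) (E : seq T) (b e : nat) : seq T :=
  drop b.-1 (take e E).

Definition on_segment (T : Type) (D : seq T) (I : nat * nat) : seq T :=
  subrange D I.1 I.2.

Definition is_segment (L : nat) (I : nat * nat) : bool :=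
  (1 <= I.1 <= I.2)%N && (I.2 <= L)%N.

Definition is_segmentation (L : nat) (P : seq (nat * nat)) : bool :=
  [&& P != [::], all (is_segment L) P,
      (head (0, 0)%N P).1 == 1%N, (last (0, 0)%N P).2 == L
    & sorted (fun I J : nat * nat => J.1 == I.2.+1) P].

Definition vec_sum (R : realType) (N : nat) (E : seq 'cV[R]_N) : 'cV[R]_N :=
  \sum_(x <- E) x.

Definition average (R : realType) (N : nat) (E : seq 'cV[R]_N) : 'cV[R]_N :=
  (size E)%:R^-1 *: vec_sum E.

Definition score_at (R : realType) (N : nat) (Z : 'cV[R]_N -> R)
    (E : seq 'cV[R]_N) (r : 'cV[R]_N) : R :=
  (size E)%:R * Z r + dot r (vec_sum E).

(* The supremum may be +oo, but never -oo. *)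
Definition score (R : realType) (N : nat) (Z : 'cV[R]_N -> R)
    (E : seq 'cV[R]_N) : \bar R :=
  ereal_sup (range (fun r => (score_at Z E r)%:E)).

Definition segmentation_score (R : realType) (N : nat) (Z : 'cV[R]_N -> R)
    (D : seq 'cV[R]_N) (P : seq (nat * nat)) : \bar R :=
  (\sum_(I <- P) score Z (on_segment D I))%E.

Definition is_cover (R : realType) (N : nat) (V : set 'cV[R]_N) : Prop :=
  forall y, exists2 v, V v & 0 <= dot y v.

Definition difference_set (R : realType) (N : nat) (E F : seq 'cV[R]_N) :
    set 'cV[R]_N :=
  [set v | exists k l : nat,
     [/\ (1 <= k <= size E)%N, (1 <= l <= size F)%N
       & v = average (subrange E k (size E)) - average (subrange F 1 l)]].

(* Main.v *)
Require Import Defs.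
From HB Require Import structures.
From mathcomp Require Import all_boot all_order all_algebra.
From mathcomp Require Import all_classical all_reals all_analysis.
From mathcomp Require Import zify lra.

Set Implicit Arguments.
Unset Strict Implicit.
Unset Printing Implicit Defensive.

Import Order.TTheory GRing.Theory Num.Theory.
Import numFieldNormedType.Exports.

Local Open Scope classical_set_scope.
Local Open Scope ring_scope.

(* Replace the supremum over all r by a maximum W over a finite set of r, and
   take a segmentation of maximal W-score with, among those, the least sum of
   right ends.  If E and F are consecutive in it, with maximizers r and s, then
   giving a suffix of E to F (parameter s) or a prefix of F to E (parameter r)
   gains nothing.  If Delta(E, F) were a cover, its element v with
   (s - r)^T v >= 0 would make both moves neutral; moving the boundary to the
   left (or merging E into F) would then lower the sum of right ends.  As there
   are finitely many segmentations, some P' of maximal score among those without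
   covers dominates every finite choice of parameters on P, hence their
   supremum, which is score(P; D), finite or not. *)

(** * Bilinearity of the product and additivity of scores *)

Lemma dotDr (R : realType) (N : nat) (x y z : 'cV[R]_N) :
  dot x (y + z) = dot x y + dot x z.
Proof. by rewrite /dot mulmxDr mxE. Qed.

Lemma dotBr (R : realType) (N : nat) (x y z : 'cV[R]_N) :
  dot x (y - z) = dot x y - dot x z.
Proof. by rewrite /dot mulmxBr !mxE. Qed.

Lemma dotZr (R : realType) (N : nat) (a : R) (x y : 'cV[R]_N) :
  dot x (a *: y) = a * dot x y.
Proof. by rewrite /dot -scalemxAr mxE. Qed.

Lemma dotBl (R : realType) (N : nat) (x y z : 'cV[R]_N) :
  dot (x - y) z = dot x z - dot y z.
Proof. by rewrite /dot linearB /= mulmxBl !mxE. Qed.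

Lemma score_at_nil (R : realType) (N : nat) (Z : 'cV[R]_N -> R)
    (r : 'cV[R]_N) :
  score_at Z [::] r = 0.
Proof. by rewrite /score_at /vec_sum big_nil /dot mulmx0 mxE mul0r addr0. Qed.

Lemma score_at_cat (R : realType) (N : nat) (Z : 'cV[R]_N -> R)
    (E F : seq 'cV[R]_N) (r : 'cV[R]_N) :
  score_at Z (E ++ F) r = score_at Z E r + score_at Z F r.
Proof.
by rewrite /score_at /vec_sum size_cat natrD big_cat /= dotDr mulrDl addrACA.
Qed.

Lemma score_at_average (R : realType) (N : nat) (Z : 'cV[R]_N -> R)
    (E : seq 'cV[R]_N) (r : 'cV[R]_N) : (0 < size E)%N ->
  score_at Z E r = (size E)%:R * (Z r + dot r (average E)).
Proof.
move=> E0; rewrite /score_at /average dotZr mulrDr mulrA divff ?mul1r //.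
by rewrite pnatr_eq0 -lt0n.
Qed.

(** * Segmentations as tilings of an interval *)

(* [chain b P c]: the segments of [P] tile the integers [n] with
   [b <= n < c]. *)
Fixpoint chain (b : nat) (P : seq (nat * nat)) (c : nat) : bool :=
  if P is J :: P' then [&& J.1 == b, (b <= J.2)%N & chain J.2.+1 P' c]
  else b == c.

Lemma chain_leq b P c : chain b P c -> (b <= c)%N.
Proof.
elim: P b => [b /eqP->//|I P IH b /= /and3P[_ bI /IH]].
by apply: leq_trans; rewrite leqW.
Qed.

Lemma chain_cat b A B c :
  chain b (A ++ B) c <-> exists2 m, chain b A m & chain m B c.
Proof.
elim: A b => [|I A IH] b /=.
  by split=> [h|[m /eqP->//]]; exists b.
split.
  by case/and3P=> -> -> /IH [m hA hB]; exists m.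
by case=> m /and3P[-> -> hA] hB; apply/IH; exists m.
Qed.

Lemma chain_bound b P c I : chain b P c -> I \in P ->
  (b <= I.1)%N && (I.1 <= I.2)%N && (I.2 < c)%N.
Proof.
elim: P b => [//|J P IH] b /= /and3P[/eqP Jb bJ hP]; rewrite inE.
case/predU1P=> [->|/(IH _ hP)/andP[/andP[h1 ->] ->]].
  by rewrite Jb leqnn bJ (chain_leq hP).
by rewrite !andbT (leq_trans _ h1) // leqW.
Qed.

Lemma chain_size b P c : chain b P c -> (size P + b <= c)%N.
Proof.
elim: P b => [b /eqP->//|I P IH b /= /and3P[_ bI /IH]].
by apply: leq_trans; rewrite addSnnS leq_add2l ltnS.
Qed.

Lemma is_segmentationE L P :
  is_segmentation L P = (P != [::]) && chain 1 P L.+1.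
Proof.
rewrite /is_segmentation; case: P => [//|J P] /=.
(* The start 1 is generalized to any positive [b], so that the induction can pass to the tail. *)
suff H b : (0 < b)%N ->
    [&& is_segment L J && all (is_segment L) P, J.1 == b, (last J P).2 == L
      & path (fun I J : nat * nat => J.1 == I.2.+1) J P] =
    [&& J.1 == b, (b <= J.2)%N & chain J.2.+1 P L.+1] by exact: H.
elim: P b J => [|K P IH] b J b0; first by rewrite /is_segment /=; lia.
have /= := IH J.2.+1 K isT; set c := [&& _, _ & chain _ _ _] => h.
(* [is_segment] asks for [J.2 <= L] explicitly; in a chain it follows from the rest of the
   tiling. *)
have cL : c -> (J.2 < L.+1)%N := @chain_leq J.2.+1 (K :: P) L.+1.
move: cL; rewrite /= -/c -h /is_segment; case: (all _ P); case: (path _ _ _) => /=;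
  lia.
Qed.

(** The bounds admit an empty left piece, [e = b.-1], and an empty right one, [e = f]. *)
Lemma on_segment_cat (T : Type) (D : seq T) (b e f : nat) :
  (b.-1 <= e)%N -> (e <= f)%N -> (e <= size D)%N ->
  on_segment D (b, f) = on_segment D (b, e) ++ on_segment D (e.+1, f).
Proof.
move=> be ef eD; rewrite /on_segment /subrange /=.
rewrite -[in LHS](cat_take_drop e (take f D)) take_takel // drop_cat.
rewrite size_takel //.
case: ltnP => // eb.
have -> : b.-1 = e by apply/eqP; rewrite eqn_leq be.
by rewrite subnn drop0 [drop e (take e D)]drop_oversize // size_takel.
Qed.

Lemma size_on_segment (T : Type) (D : seq T) (b f : nat) :
  (f <= size D)%N -> size (on_segment D (b, f)) = (f - b.-1)%N.
Proof. by move=> fD; rewrite size_drop size_takel. Qed.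

(** A segmentation has at most [L] segments, with ends at most [L], so all of them are encoded in
    one finite type. The codomain is any total order, to allow real, extended real and reversed
    integer objectives. *)
Lemma segmentation_argmax (d : Order.disp_t) (T : orderType d) (L : nat)
    (Q : seq (nat * nat) -> Prop) (F : seq (nat * nat) -> T) :
  (forall P, Q P -> is_segmentation L P) -> (exists P, Q P) ->
  exists2 P0, Q P0 & forall P, Q P -> (F P <= F P0)%O.
Proof.
move=> QL [P QP].
pose S : finType := {bseq L of 'I_L.+1 * 'I_L.+1}.
pose dec (s : S) : seq (nat * nat) :=
  [seq (nat_of_ord p.1, nat_of_ord p.2) | p <- s].
have decP P1 : Q P1 -> exists s : S, dec s = P1.
  move=> /QL; rewrite is_segmentationE => /andP[_ hP].
  have sP : (size [seq ((inord p.1, inord p.2) : 'I_L.+1 * 'I_L.+1) | p <- P1]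
             <= L)%N.
    by rewrite size_map -ltnS -addn1 chain_size.
  exists (Bseq sP); rewrite /dec /= -map_comp -[RHS]map_id.
  apply/eq_in_map => -[x y] /(chain_bound hP) /= /andP[/andP[_ xy] yL].
  by rewrite !inordK // ltnS (leq_trans xy).
have [s0 s0P] := decP _ QP.
have Qs0 : `[< Q (dec s0) >] by apply/asboolP; rewrite s0P.
case: (@Order.TotalTheory.arg_maxP _ _ _ s0 (fun s => `[< Q (dec s) >])
         (fun s => F (dec s)) Qs0) => s /asboolP Qs smax.
exists (dec s) => // P1 QP1; have [s1 s1P] := decP _ QP1.
by rewrite -s1P; apply: smax; apply/asboolP; rewrite s1P.
Qed.

(** * Optimal segmentations when the maximum over parameters is attained *)

Definition noncovering (R : realType) (N : nat) (D : seq 'cV[R]_N)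
    (P : seq (nat * nat)) : Prop :=
  forall i : nat, (i.+1 < size P)%N ->
    ~ is_cover (difference_set (on_segment D (nth (0, 0)%N P i))
                               (on_segment D (nth (0, 0)%N P i.+1))).

(* Compare the normalized gains of giving a suffix of [E] to [F] and a prefix
   of [F] to [E]: a cover makes their sum nonnegative. *)
Lemma cover_tie (R : realType) (N : nat) (Z : 'cV[R]_N -> R)
    (E F : seq 'cV[R]_N) (r s : 'cV[R]_N) :
  (forall k, (k < size E)%N ->
     score_at Z (drop k E) s <= score_at Z (drop k E) r) ->
  (forall l, (l <= size F)%N ->
     score_at Z (take l F) r <= score_at Z (take l F) s) ->
  is_cover (difference_set E F) ->
  exists2 k, (k < size E)%N &
     score_at Z (drop k E) s = score_at Z (drop k E) r.
Proof.
move=> hE hF /(_ (s - r))[_ [k [l [/andP[k0 kE] /andP[l0 lF] ->]]]].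
rewrite /subrange drop0 take_size => cov.
have kE' : (k.-1 < size E)%N by rewrite prednK.
exists k.-1 => //; apply/eqP; rewrite eq_le hE //=.
have := hF l lF.
have sE : (0 < size (drop k.-1 E))%N by rewrite size_drop subn_gt0.
have sF : (0 < size (take l F))%N by rewrite size_takel.
(* Let a and c be the averages of the suffix and the prefix. The cover gives (s - r)^T a >= (s -
   r)^T c, and the prefix inequality, divided by its length, gives (s - r)^T c >= Z r - Z s. *)
rewrite !score_at_average // !ler_pM2l ?ltr0n //.
move: cov; rewrite dotBr !dotBl; lra.
Qed.

Lemma sum_splice (V : nmodType) (T : Type) (A X B : seq T) (F : T -> V) :
  \sum_(I <- A ++ X ++ B) F I =
  \sum_(I <- X) F I + (\sum_(I <- A) F I + \sum_(I <- B) F I).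
Proof. by rewrite !big_cat /= addrCA. Qed.

(* The pieces (b, m) and (m + 1, f) with empty ones left out. *)
Definition cut (b m f : nat) : seq (nat * nat) :=
  if (m == b.-1) || (m == f) then [:: (b, f)] else [:: (b, m); (m.+1, f)].

(** The hypotheses make [W] an attained maximum of [score_at] over [A], so every segment has a
    maximizer; the supremum in [score] may be infinite or not attained. *)
Lemma noncovering_max (R : realType) (N : nat) (Z : 'cV[R]_N -> R)
    (L : nat) (D : seq 'cV[R]_N) (A : set 'cV[R]_N)
    (W : seq 'cV[R]_N -> R) :
  size D = L ->
  (forall E, exists2 r, A r & W E = score_at Z E r) ->
  (forall E r, A r -> score_at Z E r <= W E) ->
  forall P, is_segmentation L P ->
  exists P', [/\ is_segmentation L P',
    \sum_(I <- P) W (on_segment D I) <= \sum_(I <- P') W (on_segment D I)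
    & noncovering D P'].
Proof.
move=> sD Watt Wub P hP.
pose G Q := \sum_(I <- Q) W (on_segment D I).
have [P1 hP1 P1max] := @segmentation_argmax _ _ L (is_segmentation L) G
  (fun _ => id) (ex_intro _ P hP).
pose opt Q := is_segmentation L Q /\ G P1 <= G Q.
(* In the dual order [nat^d], a maximum is a least sum of right ends. *)
pose mes (Q : seq (nat * nat)) : nat^d := (\sum_(I <- Q) I.2)%N.
have [P0 [hP0 P0max] P0min] := @segmentation_argmax _ _ L opt mes
  (fun _ => @proj1 _ _) (ex_intro _ P1 (conj hP1 (lexx _))).
exists P0; split=> //; first exact: le_trans (P1max P hP) P0max.
move=> i iP0; set I := nth _ P0 i; set J := nth _ P0 i.+1 => cov.
pose X := take i P0; pose B := drop i.+2 P0.
have P0E : P0 = X ++ [:: I; J] ++ B.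
  rewrite -[LHS](cat_take_drop i); congr (_ ++ _).
  by rewrite (drop_nth (0, 0)%N) ?(drop_nth (0, 0)%N iP0) // ltnW.
move: hP0; rewrite is_segmentationE => /andP[_]; rewrite P0E.
move/chain_cat => [b hX] /=; case: (I) (J) cov P0E => [b' e] [e' f] /=.
move=> cov P0E /and5P[/eqP bb be /eqP ee ef hB]; subst b' e'.
have b0 : (0 < b)%N by exact: chain_leq hX.
have fL : (f <= L)%N by exact: chain_leq hB.
have cutseg m : (b.-1 <= m <= f)%N -> is_segmentation L (X ++ cut b m f ++ B).
  move=> /andP[bm mf]; rewrite is_segmentationE; apply/andP; split.
    by rewrite /cut; case: ifP; case: (X).
  apply/chain_cat; exists b => //; rewrite /cut; case: ifP => /=.
    by rewrite eqxx hB andbT /= (leq_trans be) // ltnW.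
  move/negbT; rewrite negb_or => /andP[mb mf']; rewrite !eqxx hB /= andbT.
  by rewrite -(prednK b0) ltn_neqAle eq_sym mb bm /= ltn_neqAle mf' mf.
have [r Ar Wr] := Watt (on_segment D (b, e)).
have [s As Ws] := Watt (on_segment D (e.+1, f)).
(* The old parameters [r] and [s] bound the new pieces from below; an omitted empty piece has score
   0. *)
have cutW m : (b.-1 <= m <= f)%N ->
    score_at Z (on_segment D (b, m)) r + score_at Z (on_segment D (m.+1, f)) s
    <= \sum_(I <- cut b m f) W (on_segment D I).
  move=> /andP[bm mf]; have mD : (m <= size D)%N by rewrite sD (leq_trans mf).
  rewrite /cut; case: eqP => [mb|_] /=.
    have /size0nil -> : size (on_segment D (b, m)) = 0%N.
      by rewrite size_on_segment // mb subnn.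
    by rewrite big_seq1 score_at_nil add0r mb prednK // Wub.
  case: eqP => [->|_].
    have /size0nil -> : size (on_segment D (f.+1, f)) = 0%N.
      by rewrite size_on_segment ?sD // subnn.
    by rewrite big_seq1 score_at_nil addr0 Wub.
  by rewrite big_cons big_seq1 lerD // Wub.
pose c := \sum_(I <- X) W (on_segment D I) + \sum_(I <- B) W (on_segment D I).
have GP0 : G P0 = score_at Z (on_segment D (b, e)) r
                + score_at Z (on_segment D (e.+1, f)) s + c.
  by rewrite /G P0E (sum_splice X [:: _; _]) big_cons big_seq1 Wr Ws.
have upper m : (b.-1 <= m <= f)%N ->
    score_at Z (on_segment D (b, m)) r + score_at Z (on_segment D (m.+1, f)) s
    <= score_at Z (on_segment D (b, e)) r
     + score_at Z (on_segment D (e.+1, f)) s.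
  move=> hm; rewrite -(lerD2r c) -GP0.
  apply: le_trans P0max; apply: le_trans (P1max _ (cutseg m hm)).
  by rewrite /G sum_splice lerD2r cutW.
have eD : (e <= size D)%N by rewrite sD (leq_trans (ltnW ef)).
have sE : size (on_segment D (b, e)) = (e - b.-1)%N by rewrite size_on_segment.
have sF : size (on_segment D (e.+1, f)) = (f - e)%N.
  by rewrite size_on_segment ?sD.
(* Giving [drop k] of the left segment away moves the boundary to [k + b.-1]; [k = 0] merges the two
   segments. *)
have Edrop k : (k < e - b.-1)%N ->
    drop k (on_segment D (b, e)) = on_segment D ((k + b.-1).+1, e).
  by move=> _; rewrite /on_segment /subrange /= drop_drop.
have Ecat k : (k < e - b.-1)%N -> on_segment D (b, e) =
    on_segment D (b, k + b.-1)%N ++ on_segment D ((k + b.-1).+1, e).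
  rewrite ltn_subRL addnC => ke; apply: on_segment_cat; first exact: leq_addl.
    exact: ltnW.
  by rewrite (leq_trans (ltnW ke)).
have krange k : (k < e - b.-1)%N -> (b.-1 <= k + b.-1 <= f)%N.
  rewrite ltn_subRL addnC leq_addl /= => ke.
  by rewrite (leq_trans (ltnW ke)) // ltnW.
have Mcat k : (k < e - b.-1)%N -> on_segment D ((k + b.-1).+1, f) =
    on_segment D ((k + b.-1).+1, e) ++ on_segment D (e.+1, f).
  rewrite ltn_subRL addnC => ke; apply: on_segment_cat => //.
    exact: ltnW.
  exact: ltnW.
have [k||k kE tie] := @cover_tie R N Z _ _ r s _ _ cov.
- rewrite sE => kE; rewrite Edrop //.
  have := upper _ (krange k kE).
  by rewrite (Ecat k kE) Mcat // !score_at_cat; lra.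
- move=> l; rewrite sF => lF.
  have lf : (e + l <= f)%N by rewrite -(subnKC (ltnW ef)) leq_add2l.
  have -> : take l (on_segment D (e.+1, f)) = on_segment D (e.+1, e + l)%N.
    by rewrite /on_segment /subrange /= take_drop take_takel // addnC.
  have h : (b.-1 <= e + l <= f)%N.
    by rewrite lf andbT (leq_trans (leq_pred b)) // (leq_trans be) // leq_addr.
  have := upper _ h.
  rewrite (@on_segment_cat _ D b e (e + l)) ?leq_addr //; last first.
    exact: leq_trans (leq_pred b) be.
  rewrite (@on_segment_cat _ D e.+1 (e + l) f) ?leq_addr //; last first.
    by rewrite sD (leq_trans lf).
  by rewrite !score_at_cat; lra.
- rewrite sE in kE; rewrite Edrop // in tie.
  have kf := krange k kE.
  (* By the tie, the moved boundary keeps the score maximal. *)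
  have : opt (X ++ cut b (k + b.-1) f ++ B).
    split; first exact: cutseg.
    apply: le_trans P0max _; rewrite GP0 /G sum_splice lerD2r.
    apply: le_trans (cutW _ kf).
    by rewrite Mcat // (Ecat k kE) !score_at_cat; lra.
  (* The right end [e] is replaced by [k + b.-1 < e], or disappears in a merge; either way the sum
     drops strictly, against minimality. *)
  move/P0min; rewrite leEdual /mes P0E leEnat !big_cat /=.
  rewrite leq_add2l !big_cons /= /cut.
  have ke : (k + b.-1 < e)%N by rewrite addnC -ltn_subRL.
  rewrite (ltn_eqF (ltn_trans ke ef)) orbF.
  have e0 : (0 < e)%N by exact: leq_trans b0 be.
  case: ifP => _; rewrite !big_cons big_nil /=; lia.
Qed.

(** * From finite choices of parameters to the supremum *)

(** The parameters of the summands vary independently, so the suprema can be taken one after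
    another. The point [u0] keeps them away from -oo. *)
Lemma sum_ereal_sup_le (R : realType) (T U : Type) (u0 : U) (F : T -> U -> R)
    (s : seq T) (M : \bar R) :
  (forall us : seq U, size us = size s ->
     ((\sum_(p <- zip s us) F p.1 p.2)%:E <= M)%E) ->
  (\sum_(i <- s) ereal_sup (range (fun u => (F i u)%:E)) <= M)%E.
Proof.
elim: s M => [|t s IH] M hM.
  by rewrite big_nil; have := hM [::] erefl; rewrite /= big_nil.
rewrite big_cons; case: M hM => [m| |] hM; last 2 first.
- exact: leey.
- by have := hM (nseq (size s).+1 u0); rewrite size_nseq => /(_ erefl).
(* With the first choice fixed, its real value is subtracted from the bound before induction. *)
have tail u : ((F t u)%:E + \sum_(i <- s) ereal_sup (range (fun u => (F i u)%:E))
              <= m%:E)%E.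
  rewrite -leeBrDl //; apply: IH => us sus.
  by rewrite leeBrDl // -EFinD; have := hM (u :: us); rewrite /= big_cons sus; apply.
case: (\sum_(i <- s) _)%E tail => [x| |] tail.
- rewrite -leeBrDr //; apply: ge_ereal_sup => _ [u _ <-].
  by rewrite leeBrDr // tail.
- by have := tail u0.
- by rewrite addeNy leNye.
Qed.

Theorem theorem1 (R : realType) (N : nat)
    (mu : {measure set (borelV R N) -> \bar R}) (q Z : 'cV[R]_N -> R)
    (hM : log_linear_model mu q Z)
    (L : nat) (D : L.-tuple 'cV[R]_N)
    (P : seq (nat * nat)) (hP : is_segmentation L P) :
  exists P' : seq (nat * nat),
    [/\ is_segmentation L P',
        (segmentation_score Z D P <= segmentation_score Z D P')%E
      & forall i : nat, (i.+1 < size P')%N ->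
          ~ is_cover (difference_set (on_segment D (nth (0, 0)%N P' i))
                                     (on_segment D (nth (0, 0)%N P' i.+1)))].
Proof.
pose good Q := is_segmentation L Q /\ noncovering D Q.
have sum_le (us : seq 'cV[R]_N) : size us = size P ->
    exists2 Q, good Q &
      ((\sum_(p <- zip P us) score_at Z (on_segment D p.1) p.2)%:E
       <= segmentation_score Z D Q)%E.
  move=> sus.
  (* The default value is the score at parameter 0, so the maximum is attained within [0 :: us]. *)
  pose W E := \big[Num.max/score_at Z E 0]_(u <- us) score_at Z E u.
  have Wub E r : r \in 0 :: us -> score_at Z E r <= W E.
    rewrite inE => /predU1P[->|rus]; first exact: bigmax_ge_id.
    exact: (le_bigmax_seq (score_at Z E 0) r xpredT (score_at Z E) rus isT).
  have Watt E : exists2 r, r \in 0 :: us & W E = score_at Z E r.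
    rewrite /W; elim: us {sus W Wub} => [|u us [r rus IH]].
      by exists 0; rewrite ?big_nil ?mem_head.
    rewrite big_cons; case: (leP (score_at Z E u) _) => _.
      by exists r => //; move: rus; rewrite !inE => /orP[->|->]; rewrite ?orbT.
    by exists u; rewrite // !inE eqxx orbT.
  have [Q [hQ PQ nQ]] := @noncovering_max R N Z L D [set` (0 :: us)] W
    (size_tuple D) Watt Wub P hP.
  exists Q; first by [].
  apply: (@le_trans _ _ (\sum_(I <- Q) W (on_segment D I))%:E); last first.
    rewrite -sumEFin; apply: lee_sum => I _.
    have [r _ ->] := Watt (on_segment D I).
    by apply: ereal_sup_ubound; exists r.
  rewrite lee_fin; apply: le_trans PQ.
  rewrite -[X in _ <= \sum_(I <- X) _](@unzip1_zip _ _ P us) ?sus //.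
  rewrite big_map big_seq [leRHS]big_seq; apply: ler_sum => -[I u] /(map_f snd).
  by rewrite -/(unzip2 _) unzip2_zip ?sus //= => uus; rewrite Wub // inE uus orbT.
have goodex : exists Q, good Q.
  by have [|Q gQ _] := sum_le (nseq (size P) 0); [rewrite size_nseq | exists Q].
(* The [Q] above depends on [us]; a best good segmentation dominates all choices at once. *)
have [Q0 [hQ0 nQ0] Q0max] := @segmentation_argmax _ _ L good
  (segmentation_score Z D) (fun _ => @proj1 _ _) goodex.
exists Q0; split=> //.
apply: (@sum_ereal_sup_le R _ _ 0
  (fun I => score_at Z (on_segment D I))) => us /sum_le[Q /Q0max QQ0].
by move=> /le_trans; apply.
Qed.
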